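(* Let $M=\begin{pmatrix}a&b\\c&d\end{pmatrix}\in\mathrm{Sp}(n,\mathbb{R})$ and let $M'\in\mathrm{Sp}(n,\mathbb{R})$ have modified pre-Iwasawa parameters $(x',y',X',Y')$ (in particular $x'=x'^t$, $y'=y'^t$, $y'>0$). Let $(x_1,y_1,X_1,Y_1)$ be the modified pre-Iwasawa parameters of the product $MM'$. Then the action $(a,b,c,d)\times(x',y',X',Y')\to(x_1,y_1,X_1,Y_1)$ is given by $$\begin{aligned}x_1+iy_1=\;&\big[c(y'+x'y'^{-1}x')c^t+dy'^{-1}d^t+cx'y'^{-1}d^t+dy'^{-1}x'c^t\big]^{-1}\\&\times\big[c(y'+x'y'^{-1}x')a^t+cx'y'^{-1}b^t+dy'^{-1}x'a^t+dy'^{-1}b^t+i\,1_n\big],\end{aligned}$$ $$X_1-iY_1=y_1^{1/2}\Big\{(cx'+d)y'^{-1/2}X'+cy'^{1/2}Y'+i\big[cy'^{1/2}X'-(cx'+d)y'^{-1/2}Y'\big]\Big\}.$$ On the other hand, let $v'=x'+iy'\in\mathcal{X}_n$ and let $\mathrm{v}_1=\mathrm{x}_1+i\,\mathrm{y}_1:=(av'+b)(cv'+d)^{-1}$ (with $\mathrm{x}_1,\mathrm{y}_1$ real) be the image of $v'$ under the linear fractional action of $M$. Then $$\mathrm{x}_1+i\,\mathrm{y}_1=(\bar v'c^t+d^t)^{-1}\Big(\frac{B}{2}+iy'\Big)(cv'+d)^{-1},$$ $$B=2\bar v'a^tcv'+\bar v'(c^tb+a^td)+(b^tc+d^ta)v'+2b^td.$$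 The modified pre-Iwasawa decomposition is compatible with the linear fractional (Möbius) action, i.e. $$x_1+iy_1=\mathrm{x}_1+i\,\mathrm{y}_1 .$$ Moreover the orthogonal symplectic matrices associated with $(X',Y')$ and $(X_1,Y_1)$ are related by $$\begin{pmatrix}X_1&Y_1\\ -Y_1&X_1\end{pmatrix}=\begin{pmatrix}y_1^{1/2}&0\\ 0&y_1^{1/2}\end{pmatrix}\begin{pmatrix}S&-T\\ T&S\end{pmatrix}\begin{pmatrix}X'&Y'\\ -Y'&X'\end{pmatrix},\qquad S=(cx'+d)y'^{-1/2},\quad T=cy'^{1/2}.$$
   Context: $\mathrm{Sp}(n,\mathbb{R})$ is the group of real $2n\times 2n$ matrices $M$ with $M^tJM=J$, $J=\begin{pmatrix}0&1_n\\-1_n&0\end{pmatrix}$; $A^t$ is the transpose. $\mathcal{X}_n=\{v=x+iy: x,y \text{ real symmetric } n\times n,\ y>0\}$ is the Siegel upper half space, on which $M=\begin{pmatrix}a&b\\c&d\end{pmatrix}\in\mathrm{Sp}(n,\mathbb{R})$ acts by $v\mapsto(av+b)(cv+d)^{-1}$. Powers of symmetric positive definite matrices are the symmetric positive definite ones. Modified pre-Iwasawa parameters: to $M=\begin{pmatrix}a&b\\c&d\end{pmatrix}\in\mathrm{Sp}(n,\mathbb{R})$ one associates $(x,y,X,Y)$ by $$y=(dd^t+cc^t)^{-1},\quad x=y(db^t+ca^t),\quad X-iY=y^{1/2}(d+ic)\ \ (X,Y\text{ real}).$$ Here $x,y$ are symmetric, $y>0$, and $X,Y$ satisfy $X^tX+Y^tY=XX^t+YY^t=1_n$,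 $X^tY=Y^tX$, $YX^t=XY^t$ (equivalently $X+iY\in\mathrm{U}(n)$). The matrix is recovered by $$a=y^{1/2}X-xy^{-1/2}Y,\quad b=y^{1/2}Y+xy^{-1/2}X,\quad c=-y^{-1/2}Y,\quad d=y^{-1/2}X.$$ *)

(* Defs.v *)
(* Mathematical Components, with MathComp-Analysis for [realType] and choice,
   and mathcomp-real-closed for the complex numbers [R[i]]. *)
From mathcomp Require Import all_boot all_order all_algebra.
From mathcomp Require Import all_classical all_reals.
From mathcomp Require Export complex.

Set Implicit Arguments.
Unset Strict Implicit.
Unset Printing Implicit Defensive.

Import GRing.Theory Num.Theory.
Local Open Scope ring_scope.
Local Open Scope complex_scope.

Notation "A %:CM" := (map_mx (real_complex _) A)
  (at level 1, left associativity, format "A %:CM") : ring_scope.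

Definition posdef (R : realType) (n : nat) (A : 'M[R]_n) : Prop :=
  A^T = A /\ (forall u : 'rV[R]_n, u != 0 -> 0 < (u *m A *m u^T) 0 0).

(* [y^{1/2}], the positive definite square root; it is only meaningful for
   positive definite [y], where it exists and is unique. The power
   [y^{-1/2}] is written [invmx (mxsqrt y)]. *)
Definition mxsqrt (R : realType) (n : nat) (y : 'M[R]_n) : 'M[R]_n :=
  xget 0 [set s : 'M[R]_n | posdef s /\ s *m s = y]%classic.

Definition symplectic_form (R : realType) (n : nat) : 'M[R]_(n + n) :=
  block_mx 0 1%:M (- 1%:M) 0.

Definition symplectic (R : realType) (n : nat) (M : 'M[R]_(n + n)) : Prop :=
  M^T *m symplectic_form R n *m M = symplectic_form R n.

Definition siegel (R : realType) (n : nat) (v : 'M[R[i]]_n) : Prop :=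
  exists x y : 'M[R]_n, [/\ x^T = x, posdef y & v = x%:CM + 'i%C *: y%:CM].

Definition moebius (R : realType) (n : nat) (M : 'M[R]_(n + n))
    (v : 'M[R[i]]_n) : 'M[R[i]]_n :=
  ((ulsubmx M)%:CM *m v + (ursubmx M)%:CM) *m
  invmx ((dlsubmx M)%:CM *m v + (drsubmx M)%:CM).

(* The tuple [(x, y, X, Y)]; the real matrices [X] and [Y] are determined by
   [X - i Y = y^{1/2} (d + i c)]. *)
Definition pre_iwasawa (R : realType) (n : nat) (M : 'M[R]_(n + n)) :
    'M[R]_n * 'M[R]_n * 'M[R]_n * 'M[R]_n :=
  let a := ulsubmx M in let b := ursubmx M in
  let c := dlsubmx M in let d := drsubmx M in
  let y := invmx (d *m d^T + c *m c^T) in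
  let x := y *m (d *m b^T + c *m a^T) in
  let U := (mxsqrt y)%:CM *m (d%:CM + 'i%C *: c%:CM) in
  (x, y, map_mx (@complex.Re R) U, - map_mx (@complex.Im R) U).

(* Main.v *)
(* The parameters (x, y) of M' = (a' b'; c' d') are read off the Gram matrix
   G = M' M'^T, whose blocks are y + x y^-1 x, x y^-1, y^-1 x, y^-1. Since
   (M M') (M M')^T = M G M^T, the parameters of M M' satisfy y1 = K^-1 and
   x1 = K^-1 N. For v = x + iy in the Siegel space and S = c vbar + d one has
     S y^-1 (v c^T + d^T) = K,   S y^-1 (v a^T + b^T) = N + i,
   and K is positive definite, so all denominators are invertible; the symmetry
   (v c^T + d^T) (a v + b) = (v a^T + b^T) (c v + d) then identifies
   (a v + b) (c v + d)^-1 with K^-1 (N + i) = x1 + i y1. *)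
Require Import Defs.
From mathcomp Require Import all_boot all_order all_algebra.
From mathcomp Require Import all_classical all_reals.
From mathcomp Require Import complex.
From mathcomp Require Import spectral.

Set Implicit Arguments.
Unset Strict Implicit.
Unset Printing Implicit Defensive.

Import Order.TTheory GRing.Theory Num.Theory.
Local Open Scope ring_scope.
Local Open Scope complex_scope.

(** * Square roots of positive definite real matrices *)

Lemma poly_interpolation (F : fieldType) (f : F -> F) (s : seq F) :
  exists p : {poly F}, forall x, x \in s -> p.[x] = f x.
Proof.
elim: s => [|a s [p pP]]; first by exists 0.
have [as_|as_] := boolP (a \in s).
  by exists p => x; rewrite inE => /orP[/eqP->|]; apply: pP.
pose q := \prod_(z <- s) ('X - z%:P).
have qa : q.[a] != 0 by rewrite -[_ == 0]/(root q a) root_prod_XsubC.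
(* Newton's step: [q] vanishes on the earlier nodes but not at [a], so the correction repairs the
   value at [a] and leaves the others alone. *)
exists (p + ((f a - p.[a]) / q.[a]) *: q) => x; rewrite inE hornerD hornerZ.
case/orP => [/eqP->|xs]; first by rewrite divfK // addrC subrK.
have /rootP-> : root q x by rewrite root_prod_XsubC.
by rewrite mulr0 addr0 pP.
Qed.

(** The spectral theorem is applied over [R[i]], where a real symmetric matrix is Hermitian. Its
    eigenvalues are real, so the diagonal descends to [R] even though [P] stays complex. *)
Lemma symmetric_diagonalization (R : rcfType) (n : nat) (A : 'M[R]_n) :
  A^T = A -> exists (P : 'M[R[i]]_n) (e : 'rV[R]_n),
    P \in unitmx /\ A%:CM = invmx P *m diag_mx (e%:CM) *m P.
Proof.
move=> symA; have hA : A%:CM \is hermsymmx.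
  apply/is_hermitianmxP; rewrite expr0 scale1r; apply/matrixP => i j.
  rewrite !mxE -[in LHS]symA mxE; apply/esym/CrealP.
  by rewrite complex_real.
have := hermitian_normalmx hA => /orthomx_spectralP eA.
exists (spectralmx A%:CM), (map_mx (@complex.Re R) (spectral_diag A%:CM)).
split; first exact: spectral_unit.
suff -> : (map_mx (@complex.Re R) (spectral_diag A%:CM))%:CM
   = spectral_diag A%:CM by [].
apply/matrixP => i j; rewrite !mxE; apply: RRe_real.
by have /mxOverP := hermitian_spectral_diag_real hA.
Qed.

Lemma posdef_unit (R : realType) (n : nat) (A : 'M[R]_n) :
  posdef A -> A \in unitmx.
Proof.
move=> [_ pA]; rewrite -row_free_unit -kermx_eq0.
apply/rowV0P => u /sub_kermxP uA; apply/eqP/negPn/negP => /pA.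
by rewrite uA mul0mx mxE ltxx.
Qed.

Lemma row_sqnorm_gt0 (R : realDomainType) (n : nat) (u : 'rV[R]_n) :
  u != 0 -> 0 < (u *m u^T) 0 0.
Proof.
have sq_ge0 i : true -> 0 <= u 0 i * u^T i 0 by rewrite mxE -expr2 sqr_ge0.
move=> u0; rewrite lt_neqAle mxE sumr_ge0 // andbT.
apply: contra u0; rewrite eq_sym psumr_eq0 // => /allP uu.
apply/eqP/rowP => i; rewrite mxE; apply/eqP.
by have := uu i (mem_index_enum i); rewrite mxE mulf_eq0 orbb.
Qed.

Lemma posdef_eigenvalue_gt0 (R : realType) (n : nat) (A : 'M[R]_n) (l : R) :
  posdef A -> eigenvalue A l -> 0 < l.
Proof.
move=> [_ pA] /eigenvalueP[u uA u0]; have := pA u u0.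
by rewrite uA -scalemxAl mxE pmulr_lgt0 // row_sqnorm_gt0.
Qed.

Lemma posdef_gram (R : realType) (n m : nat) (A : 'M[R]_(n, m)) :
  row_free A -> posdef (A *m A^T).
Proof.
move=> fA; split; first by rewrite trmx_mul trmxK.
move=> u u0; rewrite !mulmxA -mulmxA -trmx_mul; apply: row_sqnorm_gt0.
by rewrite mulmx_free_eq0.
Qed.

Lemma trmx_horner_mx (R : comNzRingType) (n : nat) (A : 'M[R]_n.+1)
    (p : {poly R}) :
  A^T = A -> (horner_mx A p)^T = horner_mx A p.
Proof.
move=> sA; elim/poly_ind: p => [|p c IH]; first by rewrite rmorph0 trmx0.
rewrite rmorphD rmorphM /= horner_mx_X horner_mx_C linearD /= tr_scalar_mx.
by rewrite [X in X + _]trmx_mul IH sA; congr (_ + _); apply: comm_mx_horner.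
Qed.

(** Polynomials commute with conjugation by [P] and act entrywise on a diagonal matrix. The
    comparison is made over [R[i]] and pulled back along the injective embedding of [R]. *)
Lemma horner_mx_spectrum (R : rcfType) (n : nat) (A : 'M[R]_n.+1)
    (P : 'M[R[i]]_n.+1) (e : 'rV[R]_n.+1) (q : {poly R}) :
  P \in unitmx -> A%:CM = invmx P *m diag_mx (e%:CM) *m P ->
  (forall i, q.[e 0 i] = e 0 i) -> horner_mx A q = A.
Proof.
move=> uP eA qe; apply: (@map_mx_inj _ _ (real_complex R)).
rewrite map_horner_mx eA (horner_mx_uconjC _ _ uP) horner_mx_diag.
suff -> : map_mx (horner (map_poly (real_complex R) q)) (e%:CM) = e%:CM by [].
by apply/rowP => i; rewrite !mxE horner_map qe.
Qed.

(* A polynomial interpolating the fourth root on the spectrum gives a real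
   symmetric matrix [r] with [r^4 = A]; then [r *m r] is the Gram matrix of the
   rows of [r], so its positivity is automatic. *)
Lemma posdef_sqrt_exists (R : realType) (n : nat) (A : 'M[R]_n) :
  posdef A -> exists s, posdef s /\ s *m s = A.
Proof.
(* [horner_mx] requires positive size; in size 0 all matrices are equal. *)
case: n A => [|n] A pA.
  by exists A; split=> //; apply/matrixP => -[].
have [sA _] := pA.
have [P [e [uP eA]]] := symmetric_diagonalization sA.
(* Row [i] of [P] is a complex eigenvector for [e 0 i]. Passing through the characteristic
   polynomial, whose roots are insensitive to the embedding, makes [e 0 i] an eigenvalue over
   [R]. *)
have eP i : 0 < e 0 i.
  apply: (posdef_eigenvalue_gt0 pA).
  rewrite eigenvalue_root_char -(fmorph_root (real_complex R)) map_char_poly.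
  rewrite -eigenvalue_root_char; apply/eigenvalueP; exists (row i P).
    rewrite eA !mulmxA -row_mul mulmxV // row1 -rowE row_diag_mx mxE.
    by rewrite -scalemxAl -rowE.
  apply/eqP => Pi; have := mul0mx 1 (invmx P).
  rewrite -{1}Pi -row_mul mulmxV // => /rowP/(_ i).
  by rewrite !mxE eqxx => /eqP; rewrite oner_eq0.
have [p pP] := poly_interpolation (fun x : R => Num.sqrt (Num.sqrt x))
  [seq e 0 i | i : 'I_n.+1].
have pe i : (p ^+ 4).[e 0 i] = e 0 i.
  rewrite horner_exp pP; last exact: (codom_f (fun i => e 0 i)).
  by rewrite -[4%N]/(2 * 2)%N exprM !sqr_sqrtr ?sqrtr_ge0 ?ltW.
pose r := horner_mx A p.
have r4 : (r *m r) *m (r *m r) = A.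
  by rewrite -[RHS](horner_mx_spectrum uP eA pe) rmorphXn
    -[4%N]/(2 * 2)%N exprM.
have sr : r^T = r by apply: trmx_horner_mx.
exists (r *m r); split=> //; rewrite -{2}sr; apply: posdef_gram.
rewrite row_free_unit; have := posdef_unit pA.
by rewrite -r4 !unitmx_mul => /andP[/andP[]].
Qed.

Lemma mxsqrtP (R : realType) (n : nat) (y : 'M[R]_n) :
  posdef y -> posdef (mxsqrt y) /\ mxsqrt y *m mxsqrt y = y.
Proof. by move=> /posdef_sqrt_exists /(xgetPex 0). Qed.

Lemma posdef_inv (R : realType) (n : nat) (A : 'M[R]_n) :
  posdef A -> posdef (invmx A).
Proof.
move=> pA; have uA := posdef_unit pA; have [sA gA] := pA.
split=> [|u u0]; first by rewrite trmx_inv sA.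
have {gA} := gA (u *m invmx A).
rewrite trmx_mul trmx_inv sA mulmxA mulmxKV //; apply.
by apply: contra_neq u0 => uA0; rewrite -[u](mulmxKV uA) uA0 mul0mx.
Qed.

(** * Block relations of symplectic matrices *)

Lemma symplectic_tr (R : realType) (n : nat) (M : 'M[R]_(n + n)) :
  symplectic M -> symplectic M^T.
Proof.
rewrite /symplectic trmxK; set J := symplectic_form R n => hM.
have JJ : J *m J = - 1%:M.
  rewrite mulmx_block !(mul0mx, mulmx0, mulmxN, mulNmx, mulmx1, add0r, addr0).
  by rewrite scalar_mx_block opp_block_mx !oppr0.
(* This left inverse of the square matrix [M] is also a right inverse, which gives the relation for
   [M^T] after multiplication by [J]. *)
have : (- (J *m M^T *m J)) *m M = 1%:M.
  by rewrite mulNmx -!mulmxA [M^T *m _]mulmxA hM JJ opprK.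
move=> /mulmx1C; rewrite mulmxN !mulmxA => /(congr1 (mulmx^~ J)).
by rewrite mulNmx -!mulmxA JJ !mulmxN mulmx1 opprK mul1mx mulmxA.
Qed.


Lemma symplectic_block (R : realType) (n : nat) (a b c d : 'M[R]_n) :
  symplectic (block_mx a b c d) ->
  [/\ a^T *m c = c^T *m a, b^T *m d = d^T *m b,
      a^T *m d = 1%:M + c^T *m b & d^T *m a = 1%:M + b^T *m c].
Proof.
rewrite /symplectic tr_block_mx !mulmx_block !(mulmx0, mulmxN, mulmx1).
rewrite !(add0r, addr0, mulNmx) => /eq_block_mx[e1 e2 e3 e4].
have e2' : a^T *m d = 1%:M + c^T *m b by rewrite -e2 addrAC addNr add0r.
split=> //; first by apply/eqP; rewrite -subr_eq0 addrC e1.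
  by apply/eqP; rewrite -subr_eq0 addrC e4.
by rewrite -[LHS]trmxK trmx_mul trmxK e2' linearD /= trmx1 trmx_mul trmxK.
Qed.

Lemma symplectic_block_tr (R : realType) (n : nat) (a b c d : 'M[R]_n) :
  symplectic (block_mx a b c d) ->
  [/\ a *m b^T = b *m a^T, c *m d^T = d *m c^T,
      a *m d^T = 1%:M + b *m c^T & d *m a^T = 1%:M + c *m b^T].
Proof.
move=> /symplectic_tr; rewrite tr_block_mx => /symplectic_block.
by rewrite !trmxK.
Qed.

(** The relation [d a^T - c b^T = 1] provides an explicit right inverse of the lower row. *)
Lemma symplectic_row_free (R : realType) (n : nat) (a b c d : 'M[R]_n) :
  symplectic (block_mx a b c d) -> row_free (row_mx c d).
Proof.
move=> /symplectic_block_tr[_ _ _ da]; apply/row_freeP.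
exists (col_mx (- b^T) a^T).
by rewrite mul_row_col da mulmxN addrCA addNr addr0.
Qed.

Lemma posdef_pre_iwasawa (R : realType) (n : nat) (a b c d : 'M[R]_n) :
  symplectic (block_mx a b c d) -> posdef (d *m d^T + c *m c^T).
Proof.
move=> /symplectic_row_free/posdef_gram.
by rewrite tr_row_mx mul_row_col addrC.
Qed.

(** * Recovering a symplectic matrix and its Gram matrix from the parameters *)

Section PreIwasawa.
Variables (R : realType) (n : nat) (a b c d : 'M[R]_n).
Hypothesis sM : symplectic (block_mx a b c d).

Let P := d *m d^T + c *m c^T.
Let y := invmx P.
Let x := y *m (d *m b^T + c *m a^T).

Let uP : P \in unitmx := posdef_unit (posdef_pre_iwasawa sM).
Let Px : P *m x = d *m b^T + c *m a^T. Proof. by rewrite mulKVmx. Qed.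

(** This and the next formula are the recovery formulas for [a] and [b] with [X = y^{1/2} d] and
    [Y = - y^{1/2} c] substituted, which eliminates the square roots. Multiplying by [P] clears [y]
    and leaves only block relations. *)
Lemma pre_iwasawa_ul : a = y *m d + x *m c.
Proof.
have [ac _ ad da] := symplectic_block sM.
apply: (can_inj (mulKmx uP)); rewrite mulmxDr mulKVmx // mulmxA Px.
by rewrite !mulmxDl -!mulmxA da -ac mulmxDr mulmx1 -addrA.
Qed.

Lemma pre_iwasawa_ur : b = x *m d - y *m c.
Proof.
have [_ bd ad da] := symplectic_block sM.
apply: (can_inj (mulKmx uP)); rewrite mulmxBr mulKVmx // mulmxA Px.
rewrite !mulmxDl -!mulmxA bd ad mulmxDr mulmx1 -addrA; congr (_ + _).
by rewrite addrAC subrr add0r.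
Qed.

Let xP : b *m d^T + a *m c^T = x *m P.
Proof.
have [_ cd _ _] := symplectic_block_tr sM.
rewrite {1}pre_iwasawa_ul {1}pre_iwasawa_ur mulmxBl !mulmxDl mulmxDr.
rewrite -!mulmxA cd.
by rewrite [X in X + _]addrC addrACA addNr add0r.
Qed.

(** [P x] and [x P] are transposes of each other and [P] is symmetric, so [P x^T = P x]. *)
Lemma pre_iwasawa_sym : x^T = x.
Proof.
have sP : P^T = P by have [] := posdef_pre_iwasawa sM.
apply: (can_inj (mulKmx uP)); rewrite Px -{1}sP -trmx_mul -xP linearD /=.
by rewrite !trmx_mul !trmxK.
Qed.

Lemma pre_iwasawa_gram :
  block_mx a b c d *m (block_mx a b c d)^T =
  block_mx (y + x *m invmx y *m x) (x *m invmx y) (invmx y *m x) (invmx y).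
Proof.
have sy : y^T = y by have [] := posdef_inv (posdef_pre_iwasawa sM).
have [_ _ ad _] := symplectic_block_tr sM.
(* Only the transposed factors are expanded: the terms in [v] collect to [(a d^T - b c^T) v = v],
   those in [u] to [(b d^T + a c^T) u]. *)
have key (u v : 'M[R]_n) : u^T = u -> v^T = v ->
    a = v *m d + u *m c -> b = u *m d - v *m c ->
    a *m a^T + b *m b^T = v + (b *m d^T + a *m c^T) *m u.
  move=> su sv ea eb.
  have aT : a^T = d^T *m v + c^T *m u by rewrite ea linearD /= !trmx_mul su sv.
  have bT : b^T = d^T *m u - c^T *m v by rewrite eb linearB /= !trmx_mul su sv.
  rewrite aT bT mulmxBr !mulmxDr mulmxDl !mulmxA ad mulmxDl mul1mx.
  by rewrite [v + _ + _]addrAC addrACA subrr addr0 -addrA [X in v + X]addrC.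
rewrite tr_block_mx mulmx_block /y invmxK -/P -/y; congr block_mx.
- by rewrite -xP (key x y) ?pre_iwasawa_sym //;
    [exact: pre_iwasawa_ul | exact: pre_iwasawa_ur].
- by rewrite -xP addrC.
- by rewrite Px addrC.
- by rewrite addrC.
Qed.

End PreIwasawa.

(** * Positivity of the denominator [K] *)

Lemma posdef_ge0 (R : realType) (n : nat) (A : 'M[R]_n) (u : 'rV[R]_n) :
  posdef A -> 0 <= (u *m A *m u^T) 0 0.
Proof.
move=> [_ pA]; have [->|/pA/ltW//] := eqVneq u 0.
by rewrite !mul0mx mxE.
Qed.

(** Completing the square gives [c y c^T + (c x + d) y^-1 (c x + d)^T], a sum of two nonnegative
    forms. If the first vanishes at [u], then [u c = 0] and the second is evaluated at [u d], which
    is nonzero because the row [(c d)] is free. *)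
Lemma posdef_moebius_gram (R : realType) (n : nat) (a b c d x y : 'M[R]_n) :
  symplectic (block_mx a b c d) -> x^T = x -> posdef y ->
  posdef (c *m (y + x *m invmx y *m x) *m c^T + d *m invmx y *m d^T
          + c *m x *m invmx y *m d^T + d *m invmx y *m x *m c^T).
Proof.
move=> sM sx py; have pz := posdef_inv py.
have -> : c *m (y + x *m invmx y *m x) *m c^T + d *m invmx y *m d^T
          + c *m x *m invmx y *m d^T + d *m invmx y *m x *m c^T
        = c *m y *m c^T + (c *m x + d) *m invmx y *m (c *m x + d)^T.
  rewrite [(_ + _)^T]linearD /= trmx_mul sx !(mulmxDl, mulmxDr) !mulmxA.
  by rewrite -!addrA; congr (_ + (_ + _)); rewrite addrC -addrA.
have [sy _] := py; have [sz _] := pz; split.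
  by rewrite [LHS]linearD /= !trmx_mul !trmxK sy sz !mulmxA.
move=> u u0.
have -> : u *m (c *m y *m c^T
                + (c *m x + d) *m invmx y *m (c *m x + d)^T) *m u^T
  = (u *m c) *m y *m (u *m c)^T
    + (u *m (c *m x + d)) *m invmx y *m (u *m (c *m x + d))^T.
  by rewrite mulmxDr mulmxDl !trmx_mul !mulmxA.
rewrite mxE; have [uc0|uc] := eqVneq (u *m c) 0; last first.
  by apply: ltr_pwDl; [case: py => _; apply | apply: posdef_ge0].
apply: ltr_wpDl; first exact: posdef_ge0.
case: pz => _; apply; rewrite mulmxDr mulmxA uc0 mul0mx add0r.
apply: contra u0 => /eqP ud0.
rewrite -(mulmx_free_eq0 _ (symplectic_row_free sM)).
by rewrite mul_mx_row uc0 ud0 row_mx0.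
Qed.

(** * Complex matrices through their real and imaginary parts *)

Section ComplexMatrix.
Variable R : rcfType.

Definition cmx m n (A B : 'M[R]_(m, n)) : 'M[R[i]]_(m, n) :=
  A%:CM + 'i%C *: B%:CM.

Lemma cmx_real m n (A : 'M[R]_(m, n)) : A%:CM = cmx A 0.
Proof. by rewrite /cmx map_mx0 scaler0 addr0. Qed.

Lemma cmx_mul m n p (A B : 'M[R]_(m, n)) (C D : 'M[R]_(n, p)) :
  cmx A B *m cmx C D = cmx (A *m C - B *m D) (A *m D + B *m C).
Proof.
rewrite /cmx mulmxDl !mulmxDr -!scalemxAl -!scalemxAr scalerA -expr2 sqr_i.
rewrite map_mxB map_mxD !map_mxM scaleN1r scalerDr -!addrA; congr (_ + _).
by rewrite addrA addrC.
Qed.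

Lemma cmx_add m n (A B C D : 'M[R]_(m, n)) :
  cmx A B + cmx C D = cmx (A + C) (B + D).
Proof. by rewrite /cmx !map_mxD scalerDr addrACA. Qed.

Lemma cmx_affinel n (e f x y : 'M[R]_n) :
  e%:CM *m cmx x y + f%:CM = cmx (e *m x + f) (e *m y).
Proof. by rewrite !cmx_real cmx_mul cmx_add !mul0mx subr0 !addr0. Qed.

Lemma cmx_affiner n (e f x y : 'M[R]_n) :
  cmx x y *m e%:CM + f%:CM = cmx (x *m e + f) (y *m e).
Proof. by rewrite !cmx_real cmx_mul cmx_add !mulmx0 subr0 add0r !addr0. Qed.

Lemma Re_cmx m n (A B : 'M[R]_(m, n)) : map_mx (@complex.Re R) (cmx A B) = A.
Proof.
by apply/matrixP => i j; rewrite !mxE /= !(mul0r, mul1r, mulr0, subr0, addr0).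
Qed.

Lemma Im_cmx m n (A B : 'M[R]_(m, n)) : map_mx (@complex.Im R) (cmx A B) = B.
Proof.
by apply/matrixP => i j; rewrite !mxE /= !(mul0r, mul1r, mulr0, add0r).
Qed.

Lemma conj_cmx m n (A B : 'M[R]_(m, n)) :
  map_mx (@conjc R) (cmx A B) = cmx A (- B).
Proof. by apply/matrixP => i j; rewrite !mxE; simpc. Qed.

(** With [e] and [f] left free, one computation covers both factorizations: [(c^T, d^T)] has
    imaginary part 0 and yields [K], while [(a^T, b^T)] has imaginary part 1 and yields [N + i]. The
    left factor is [c vbar + d]. *)
Lemma cmx_sandwich n (c d e f x y : 'M[R]_n) : y \in unitmx ->
  cmx (c *m x + d) (- (c *m y)) *m (invmx y)%:CM *m cmx (x *m e + f) (y *m e)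
  = cmx (c *m (y + x *m invmx y *m x) *m e + d *m invmx y *m f
         + c *m x *m invmx y *m f + d *m invmx y *m x *m e)
        (d *m e - c *m f).
Proof.
move=> uy; rewrite cmx_real !cmx_mul !mulmx0 subr0 add0r mulNmx mulmxK //.
congr cmx.
  rewrite mulNmx opprK addrC !(mulmxDl, mulmxDr) !mulmxA -!addrA.
  by congr (_ + (_ + _)); rewrite [LHS]addrCA [RHS]addrCA [X in _ = _ + X]addrC.
rewrite mulNmx mulmxA mulmxKV // mulmxDl mulmxDr !mulmxA opprD addrACA subrr.
by rewrite add0r.
Qed.

End ComplexMatrix.

Lemma pre_iwasawa_block (R : realType) (n : nat) (a b c d x y X Y : 'M[R]_n) :
  pre_iwasawa (block_mx a b c d) = (x, y, X, Y) ->
  [/\ y = invmx (d *m d^T + c *m c^T), x = y *m (d *m b^T + c *m a^T),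
      X = mxsqrt y *m d & Y = - (mxsqrt y *m c)].
Proof.
rewrite /pre_iwasawa block_mxKul block_mxKur block_mxKdl block_mxKdr.
case=> <- <- <- <-; split=> //.
  by rewrite -/(cmx d c) cmx_real cmx_mul !mul0mx Re_cmx subr0.
by rewrite -/(cmx d c) cmx_real cmx_mul !mul0mx Im_cmx addr0.
Qed.

(* For [w = v] this is the symmetry of [(a v + b) (c v + d)^-1]. *)
Lemma moebius_cross (T : pzRingType) (n : nat)
    (a b c d a' b' c' d' v w : 'M[T]_n) :
  a' *m c = c' *m a -> b' *m d = d' *m b ->
  a' *m d = 1%:M + c' *m b -> d' *m a = 1%:M + b' *m c ->
  (w *m c' + d') *m (a *m v + b) + w = (w *m a' + b') *m (c *m v + d) + v.
Proof.
move=> ac bd ad da.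
rewrite !(mulmxDl, mulmxDr) -!mulmxA ad bd !(mulmxA _ _ v) ac da.
rewrite mulmxDr mulmx1 mulmxDl mul1mx !mulmxA.
rewrite -!addrA; congr (_ + _); rewrite [RHS]addrCA; congr (_ + _).
by rewrite !(addrA _ _ w) !(addrA _ _ v) [LHS]addrC [LHS]addrCA [RHS]addrC.
Qed.

(** The left side is the matrix [B]. One copy of each doubled term is rewritten by [a' c = c' a] or
    [b' d = d' b], and the eight terms then regroup into two products. *)
Lemma moebius_split (T : pzRingType) (n : nat)
    (a b c d a' b' c' d' v w : 'M[T]_n) :
  a' *m c = c' *m a -> b' *m d = d' *m b ->
  2 *: (w *m a' *m c *m v) + w *m (c' *m b + a' *m d)
    + (b' *m c + d' *m a) *m v + 2 *: (b' *m d)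
  = (w *m c' + d') *m (a *m v + b) + (w *m a' + b') *m (c *m v + d).
Proof.
move=> ac bd.
have aw : w *m a' *m c *m v = w *m c' *m a *m v.
  by rewrite -!mulmxA !(mulmxA _ _ v) ac.
rewrite !scaler_nat !mulr2n {1}aw {1}bd !(mulmxDl, mulmxDr) !mulmxA.
by rewrite [X in _ + X + _]addrC [X in X + _ + _]addrACA -[LHS]addrA
  [X in _ + X = _]addrACA [LHS]addrACA.
Qed.

(** * The linear fractional action on the Siegel space *)

Section MoebiusAction.
Variables (R : realType) (n : nat) (a b c d x y : 'M[R]_n).
Hypothesis sM : symplectic (block_mx a b c d).
Hypotheses (sx : x^T = x) (py : posdef y).

Let v := cmx x y.
Let w := map_mx (@conjc R) v.
Let K := c *m (y + x *m invmx y *m x) *m c^T + d *m invmx y *m d^T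
  + c *m x *m invmx y *m d^T + d *m invmx y *m x *m c^T.
Let N := c *m (y + x *m invmx y *m x) *m a^T
  + c *m x *m invmx y *m b^T + d *m invmx y *m x *m a^T
  + d *m invmx y *m b^T.

Let S := cmx (c *m x + d) (- (c *m y)).

Lemma moebius_gram_factor :
  S *m (invmx y)%:CM *m (v *m (c^T)%:CM + (d^T)%:CM) = K%:CM.
Proof.
have [_ cd _ _] := symplectic_block_tr sM.
by rewrite cmx_affiner cmx_sandwich ?posdef_unit // cd subrr -cmx_real.
Qed.

Lemma moebius_num_factor :
  S *m (invmx y)%:CM *m (v *m (a^T)%:CM + (b^T)%:CM) = cmx N 1%:M.
Proof.
have [_ _ _ da] := symplectic_block_tr sM.
have e1 : d *m a^T - c *m b^T = 1%:M by rewrite da addrK.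
rewrite cmx_affiner (cmx_sandwich _ _ _ _ _ (posdef_unit py)) e1.
congr cmx; rewrite /N -!addrA; congr (_ + _).
by rewrite [LHS]addrC -addrA.
Qed.

(** Every factor in the factorization of the invertible [K] is invertible. The remaining two
    denominators are complex conjugates of such factors: [c v + d] of [S], and [w c^T + d^T] of
    [v c^T + d^T]. *)
Lemma moebius_unit : [/\ K%:CM \in unitmx, c%:CM *m v + d%:CM \in unitmx,
  v *m (c^T)%:CM + (d^T)%:CM \in unitmx &
  w *m (c^T)%:CM + (d^T)%:CM \in unitmx].
Proof.
have uK : K%:CM \in unitmx.
  by rewrite map_unitmx; apply/posdef_unit/(posdef_moebius_gram sM).
move: (uK); rewrite -{1}moebius_gram_factor !unitmx_mul.
move=> /andP[/andP[uS _] uE].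
split; [exact: uK | | exact: uE |].
  have -> : c%:CM *m v + d%:CM = map_mx (@conjc R) S.
    by rewrite cmx_affinel conj_cmx opprK.
  by rewrite map_unitmx.
have -> : w *m (c^T)%:CM + (d^T)%:CM
    = map_mx (@conjc R) (v *m (c^T)%:CM + (d^T)%:CM).
  by rewrite /w conj_cmx !cmx_affiner conj_cmx mulNmx.
by rewrite map_unitmx.
Qed.

(** The case [u = v] gives the symmetry used for [K^-1 (N + i)]; the case [u = w] gives the
    Hermitian formula with [B]. *)
Let moebius_crossC (u : 'M[R[i]]_n) :
  (u *m (c^T)%:CM + (d^T)%:CM) *m (a%:CM *m v + b%:CM) + u
  = (u *m (a^T)%:CM + (b^T)%:CM) *m (c%:CM *m v + d%:CM) + v.
Proof.
have [ac bd ad da] := symplectic_block sM.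
apply: moebius_cross; rewrite -!map_mxM -?(map_mx1 (real_complex R)) -?map_mxD.
- by rewrite ac.
- by rewrite bd.
- by rewrite ad.
- by rewrite da.
Qed.

Lemma moebius_gramE :
  moebius (block_mx a b c d) v = invmx K%:CM *m (N%:CM + 'i%C *: 1%:M).
Proof.
have [uK uD _ _] := moebius_unit.
apply: (can_inj (mulKmx uK)); rewrite mulKVmx //.
rewrite /moebius block_mxKul block_mxKur block_mxKdl block_mxKdr.
rewrite -moebius_gram_factor !mulmxA -(mulmxA _ _ (a%:CM *m v + b%:CM)).
rewrite (addIr v (moebius_crossC v)) mulmxA mulmxK //.
by rewrite moebius_num_factor /cmx map_mx1.
Qed.

(** Put [L = (w c^T + d^T) (a v + b)]. The cross relation at [w] turns [B] into [2 L + w - v], and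
    [i y = (v - w) / 2], so [B / 2 + i y = L]. *)
Lemma moebius_hermitianE :
  moebius (block_mx a b c d) v =
  invmx (w *m (c^T)%:CM + (d^T)%:CM)
  *m (2^-1 *: (2 *: (w *m (a^T)%:CM *m c%:CM *m v)
               + w *m (c^T *m b + a^T *m d)%:CM
               + (b^T *m c + d^T *m a)%:CM *m v
               + 2 *: (b^T *m d)%:CM) + 'i%C *: y%:CM)
  *m invmx (c%:CM *m v + d%:CM).
Proof.
have [uK uD _ uE] := moebius_unit.
rewrite /moebius block_mxKul block_mxKur block_mxKdl block_mxKdr.
congr (_ *m _); apply: (can_inj (mulKmx uE)); rewrite mulKVmx //.
set L := LHS.
have -> : 'i%C *: y%:CM = 2^-1 *: (v - w).
  rewrite /w conj_cmx /v /cmx map_mxN scalerN opprD opprK addrACA subrr add0r.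
  by rewrite -scalerDl scalerA -mulr2n -['i%C *+ 2]mulr_natl mulKf ?pnatr_eq0.
rewrite -scalerDr.
suff -> : 2 *: (w *m (a^T)%:CM *m c%:CM *m v)
   + w *m (c^T *m b + a^T *m d)%:CM + (b^T *m c + d^T *m a)%:CM *m v
   + 2 *: (b^T *m d)%:CM = L + L + w - v.
  rewrite addrA subrK addrK -mulr2n -[L *+ 2]scaler_nat scalerA.
  by rewrite mulVf ?scale1r // pnatr_eq0.
have abel (V : zmodType) (l t q u : V) : l + t = q + u -> l + l + t - u = l + q.
  by move=> e; rewrite -(addrA l) e addrA addrK.
rewrite (abel _ _ _ _ _ (moebius_crossC w)).
have [ac bd _ _] := symplectic_block sM.
rewrite !map_mxD !map_mxM; apply: moebius_split; rewrite -!map_mxM.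
  by rewrite ac.
by rewrite bd.
Qed.

End MoebiusAction.

(** * Parameters of the product and compatibility with the action *)

Theorem lemma5 (R : realType) (n : nat)
    (a b c d : 'M[R]_n) (M' : 'M[R]_(n + n))
    (x' y' X' Y' x1 y1 X1 Y1 : 'M[R]_n)
    (hM : symplectic (block_mx a b c d)) (hM' : symplectic M')
    (hpar' : pre_iwasawa M' = (x', y', X', Y'))
    (hpar1 : pre_iwasawa (block_mx a b c d *m M') = (x1, y1, X1, Y1)) :
  let S := (c *m x' + d) *m invmx (mxsqrt y') in
  let T := c *m mxsqrt y' in
  let K := c *m (y' + x' *m invmx y' *m x') *m c^T + d *m invmx y' *m d^T
           + c *m x' *m invmx y' *m d^T + d *m invmx y' *m x' *m c^T in
  let N := c *m (y' + x' *m invmx y' *m x') *m a^T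
           + c *m x' *m invmx y' *m b^T + d *m invmx y' *m x' *m a^T
           + d *m invmx y' *m b^T in
  siegel (x'%:CM + 'i%C *: y'%:CM)
  /\ (K \in unitmx
      /\ x1%:CM + 'i%C *: y1%:CM = invmx K%:CM *m (N%:CM + 'i%C *: 1%:M))
  /\ X1%:CM - 'i%C *: Y1%:CM =
      (mxsqrt y1)%:CM *m
      (((c *m x' + d) *m invmx (mxsqrt y') *m X' + c *m mxsqrt y' *m Y')%:CM
       + 'i%C *: (c *m mxsqrt y' *m X'
                - (c *m x' + d) *m invmx (mxsqrt y') *m Y')%:CM)
  /\ (forall x y : 'M[R]_n,
        let v := x%:CM + 'i%C *: y%:CM in
        let vbar := map_mx (@conjc R) v in
        let B := 2 *: (vbar *m (a^T)%:CM *m c%:CM *m v)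
                 + vbar *m (c^T *m b + a^T *m d)%:CM
                 + (b^T *m c + d^T *m a)%:CM *m v
                 + 2 *: (b^T *m d)%:CM in
        siegel v ->
        [/\ c%:CM *m v + d%:CM \in unitmx,
            vbar *m (c^T)%:CM + (d^T)%:CM \in unitmx
          & moebius (block_mx a b c d) v =
              invmx (vbar *m (c^T)%:CM + (d^T)%:CM)
              *m (2^-1 *: B + 'i%C *: y%:CM)
              *m invmx (c%:CM *m v + d%:CM)])
  /\ x1%:CM + 'i%C *: y1%:CM =
      moebius (block_mx a b c d) (x'%:CM + 'i%C *: y'%:CM)
  /\ block_mx X1 Y1 (- Y1) X1 =
      block_mx (mxsqrt y1) 0 0 (mxsqrt y1)
      *m block_mx S (- T) T S
      *m block_mx X' Y' (- Y') X'.
Proof.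
move=> S T K N.
have := hpar'; have := hM'; rewrite -[M']submxK.
set a' := ulsubmx M'; set b' := ursubmx M'.
set c' := dlsubmx M'; set d' := drsubmx M' => sM'.
move=> /pre_iwasawa_block[ey' ex' eX' eY'].
have py' : posdef y' by rewrite ey'; exact/posdef_inv/(posdef_pre_iwasawa sM').
have sx' : x'^T = x' by rewrite ex' ey'; exact: (pre_iwasawa_sym sM').
have gM' := pre_iwasawa_gram sM'; rewrite -ey' -ex' in gM'.
have ea' : a' = y' *m d' + x' *m c'.
  by rewrite ex' ey'; exact: (pre_iwasawa_ul sM').
have eb' : b' = x' *m d' - y' *m c'.
  by rewrite ex' ey'; exact: (pre_iwasawa_ur sM').
have gM1 : (block_mx a b c d *m block_mx a' b' c' d')
    *m (block_mx a b c d *m block_mx a' b' c' d')^T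
  = block_mx a b c d *m (block_mx a' b' c' d' *m (block_mx a' b' c' d')^T)
    *m (block_mx a b c d)^T by rewrite [in LHS]trmx_mul !mulmxA.
have := hpar1; rewrite -[M']submxK -/a' -/b' -/c' -/d'.
move: gM1; rewrite gM' mulmx_block.
set a1 := a *m a' + _; set b1 := a *m b' + _.
set c1 := c *m a' + _; set d1 := c *m b' + _.
(* The lower blocks of the Gram matrix of the product are [c1 a1^T + d1 b1^T] and
   [c1 c1^T + d1 d1^T], which become [N] and [K]. *)
rewrite !tr_block_mx !mulmx_block => /eq_block_mx[_ _ eQ eP].
move=> /pre_iwasawa_block[ey1 ex1 eX1 eY1].
have eK : d1 *m d1^T + c1 *m c1^T = K.
  rewrite addrC eP /K !(mulmxDl, mulmxDr) !mulmxA -!addrA.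
  by congr (_ + (_ + _)); rewrite [LHS]addrCA [RHS]addrCA [X in _ = _ + X]addrC.
have eN : d1 *m b1^T + c1 *m a1^T = N.
  rewrite addrC eQ /N !(mulmxDl, mulmxDr) !mulmxA -!addrA.
  by congr (_ + (_ + _)); rewrite [LHS]addrCA.
have uK : K \in unitmx := posdef_unit (posdef_moebius_gram hM sx' py').
have iwasawa1 : x1%:CM + 'i%C *: y1%:CM = invmx K%:CM *m (N%:CM + 'i%C *: 1%:M).
  by rewrite ex1 ey1 eK eN map_mxM map_invmx mulmxDr -scalemxAr mulmx1.
have [py1s s1] := mxsqrtP py'.
have us : mxsqrt y' \in unitmx := posdef_unit py1s.
(* The roots cancel: [S X' = (c x' + d) d'] and [T Y' = - c y' c'], whose sum is [c b' + d d'] by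
   the recovery formula for [b']. The formula for [c1] follows in the same way from [a']. *)
have ed1 : d1 = S *m X' + T *m Y'.
  rewrite /S /T eX' eY' !mulmxA mulmxKV // mulmxN mulmxA -(mulmxA c) s1.
  by rewrite /d1 eb' mulmxBr mulmxDl !mulmxA addrAC.
have ec1 : c1 = T *m X' - S *m Y'.
  rewrite /S /T eX' eY' mulmxN opprK !mulmxA mulmxKV // -(mulmxA c) s1.
  by rewrite /c1 ea' mulmxDr mulmxDl !mulmxA addrA.
split; first by exists x', y'.
split; first by split.
split.
  rewrite -/S -/T -ed1 -ec1 eX1 eY1 map_mxN scalerN opprK !map_mxM.
  by rewrite mulmxDr -scalemxAr.
split.
  move=> x y v vbar B [x0 [y0 [sx0 py0 ev]]].
  (* [siegel] supplies its own witnesses; real and imaginary parts identify them with [x] and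
     [y]. *)
  have [ex ey] : x = x0 /\ y = y0.
    have ecmx : cmx x y = cmx x0 y0 by [].
    split; first by rewrite -(Re_cmx x y) ecmx Re_cmx.
    by rewrite -(Im_cmx x y) ecmx Im_cmx.
  rewrite -{}ex -{}ey in sx0 py0; have [_ uD _ uE] := moebius_unit hM sx0 py0.
  by split; [exact: uD | exact: uE | exact: (moebius_hermitianE hM sx0 py0)].
split.
  by rewrite iwasawa1 (moebius_gramE hM sx' py').
(* This is the real block form of [X1 + i Y1 = y1^{1/2} (S - i T) (X' + i Y')], the conjugate of the
   formula for [X1 - i Y1]. *)
rewrite !(mul0mx, add0r, addr0) eX1 eY1 ed1 ec1.
rewrite !(mulmxN, mulNmx) !opprK mulmxBr mulmxDr opprB !mulmxA.
by congr block_mx; rewrite // addrC.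
Qed.
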